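(* Let $a<b$ be real numbers, let $g:\mathbb{R}\to\mathbb{R}$ be non-decreasing and left continuous, and let $f\in\operatorname{BC}_g([a,b],\mathbb{F})$ be such that $f(t^+)$ exists for every $t\in D_g\cap[a,b)$. The following are equivalent: 1. $\sum_{t\in D_g\cap[a,b)}|\Delta f(t)|<\infty$. 2. $D_g\cap[a,b)$ is finite or, for every sequence $\{t_n\}_{n\in\mathbb{N}}$ of pairwise distinct points of $D_g\cap[a,b)$, the sequence $(f_n)_{n\in\mathbb{N}}$ given by $$f_n(t):=\sum_{\substack{1\leqslant k\leqslant n\\ t_k<t}}\Delta f(t_k),\qquad t\in[a,b],$$ is convergent in $\operatorname{BC}_g([a,b],\mathbb{F})$. 3. The function $h$ given by $h(t):=f_g'(t)$ if $t\in D_g\cap[a,b)$ and $h(t):=0$ for all other $t\in[a,b]$ is well defined and belongs to $L^1_g([a,b],\mathbb{F})$. 4. The function $f^B(t)=\sum_{s\in[a,t)}\Delta f(s)$, $t\in[a,b]$, is well defined, $f^B\in\operatorname{AC}_{g^B}([a,b],\mathbb{F})\cap\operatorname{AC}_g([a,b],\mathbb{F})$ and $f^C:=f-f^B\in\operatorname{BC}_g([a,b],\mathbb{F})\cap\operatorname{BC}([a,b],\mathbb{F})$.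
   Context: $\mathbb{F}$ is $\mathbb{R}$ or $\mathbb{C}$. For a function $\varphi$, $\varphi(t^+)$ is the right-hand limit at $t$ and $\Delta\varphi(t)=\varphi(t^+)-\varphi(t)$; $D_g=\{t\in\mathbb{R}:\Delta g(t)>0\}$ (countable). A function $f:[a,b]\to\mathbb{F}$ is $g$-continuous if for every $t\in[a,b]$ and $\varepsilon>0$ there is $\delta>0$ with $|f(t)-f(s)|<\varepsilon$ for all $s\in[a,b]$ with $|g(t)-g(s)|<\delta$; $\operatorname{BC}_g([a,b],\mathbb{F})$ is the Banach space of bounded $g$-continuous functions with the supremum norm, and $\operatorname{BC}([a,b],\mathbb{F})$ that of bounded continuous functions (usual sense). A $g$-continuous $f$ is continuous at every point of $[a,b)$ where $g$ is continuous, so $\Delta f(s)=0$ for $s\in[a,b)\setminus D_g$. Sums over (uncountable or countable) index sets without specified order are unordered sums, well defined when absolutely convergent. For $t\in D_g\cap[a,b)$, the Stieltjes derivative is $f_g'(t)=\lim_{s\to t^+}\frac{f(s)-f(t)}{g(s)-g(t)}=\Delta f(t)/\Delta g(t)$. $\mu_g$ is the Lebesgue–Stieltjes measure of $g$, with $\mu_g([x,y))=g(y)-g(x)$, and $L^1_g$ the corresponding $L^1$ space. The jump part of $g$ is $g^B(t)=\sum_{s\in[0,t)\cap D_g}\Delta g(s)$ for $t>0$ and $g^B(t)=-\sum_{s\in[t,0)\cap D_g}\Delta g(s)$ for $t\leqslant0$. For a non-decreasing left continuous $k:\mathbb{R}\to\mathbb{R}$, $\operatorname{AC}_k([a,b],\mathbb{F})$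 is the set of functions $F:[a,b]\to\mathbb{F}$ such that for every $\varepsilon>0$ there is $\delta>0$ such that for every finite family of pairwise disjoint subintervals $\{(c_n,d_n)\}_{n=1}^m$ of $[a,b]$, $\sum_{n}(k(d_n)-k(c_n))<\delta$ implies $\sum_n|F(d_n)-F(c_n)|<\varepsilon$. *)

(* Defs.v *)
From HB Require Import structures.
From mathcomp Require Import all_boot all_order all_algebra.
From mathcomp Require Import complex.
From mathcomp Require Import all_classical all_reals all_analysis.
From mathcomp Require Import summability ring.

Set Implicit Arguments.
Unset Strict Implicit.
Unset Printing Implicit Defensive.
Import Order.TTheory GRing.Theory Num.Theory.
Import numFieldNormedType.Exports.
Local Open Scope classical_set_scope.
Local Open Scope ring_scope.

(* [Rcomplex R] is the copy of [R[i]] whose norm is the real-valued modulus and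
   whose scalars are [R]; here it also receives the induced topology. *)
Section Rcomplex_normedModType.
Variable R : realType.

HB.instance Definition _ :=
  PseudoMetric.copy (Rcomplex R) (pseudoMetric_normed (Rcomplex R)).

HB.instance Definition _ := isPointed.Build (Rcomplex R) 0.

HB.instance Definition _ :=
  NormedZmod_PseudoMetric_eq.Build R (Rcomplex R) erefl.

Lemma Rcomplex_normrZ (l : R) (x : Rcomplex R) : `|l *: x| = `|l| * `|x|.
Proof.
case: x => x y; rewrite /Num.norm/= !exprMn -mulrDr sqrtrM ?sqr_ge0//.
by rewrite sqrtr_sqr.
Qed.

HB.instance Definition _ :=
  PseudoMetricNormedZmod_Lmodule_isNormedModule.Build R (Rcomplex R)
    Rcomplex_normrZ.

End Rcomplex_normedModType.

Variant scalar_field := RealScalars | ComplexScalars.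

Definition scalars (R : realType) (F : scalar_field) : normedModType R :=
  match F with
  | RealScalars => R^o
  | ComplexScalars => Rcomplex R
  end.

Section jumps.
Context {R : realType} {V : normedModType R}.

Definition rlim (f : R -> V) (t : R) : V := lim (f s @[s --> t^'+]).

Definition jump (f : R -> V) (t : R) : V := rlim f t - f t.

End jumps.

(* the set D_g *)
Definition jump_set {R : realType} (g : R -> R) : set R :=
  [set t | 0 < jump (g : R -> R^o) t].

(* the jump part g^B *)
Definition jump_part {R : realType} (g : R -> R) (t : R) : R :=
  if 0 < t
  then fine (\esum_(s in `[0, t[ `&` jump_set g) (jump (g : R -> R^o) s)%:E)
  else - fine (\esum_(s in `[t, 0[ `&` jump_set g) (jump (g : R -> R^o) s)%:E).

(* Functions on [a, b] are represented by functions on R of which only the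
   values on [a, b] are used. *)
Section function_spaces.
Context {R : realType} {V : normedModType R}.
Implicit Types (a b : R) (g k : R -> R) (f : R -> V).

Definition bounded_itv a b f :=
  exists M : R, forall t, t \in `[a, b] -> `|f t| <= M.

Definition g_continuous g a b f :=
  forall t, t \in `[a, b] -> forall e : R, 0 < e ->
  exists2 d : R, 0 < d &
    forall s, s \in `[a, b] -> `|g t - g s| < d -> `|f t - f s| < e.

Definition BCg g a b f := bounded_itv a b f /\ g_continuous g a b f.

Definition BC a b f := bounded_itv a b f /\ {within `[a, b], continuous f}.

Definition sup_norm a b f : R := sup [set `|f t| | t in `[a, b]].

Definition cvg_in_BCg g a b (u : nat -> R -> V) :=
  (forall n, BCg g a b (u n)) /\
  exists2 v, BCg g a b v & sup_norm a b (u n \- v) @[n --> \oo] --> 0.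

Definition abs_cont k a b f :=
  forall e : R, 0 < e -> exists2 delta : R, 0 < delta &
  forall (m : nat) (c d : 'I_m -> R),
    (forall n, [/\ a <= c n, c n < d n & d n <= b]) ->
    trivIset setT (fun n => [set` `]c n, d n[]) ->
    \sum_n (k (d n) - k (c n)) < delta ->
    \sum_n `|f (d n) - f (c n)| < e.

Definition abs_summable (A : set R) (u : R -> V) :=
  (\esum_(s in A) (`|u s|)%:E < +oo)%E.

Definition unordered_sum (A : set R) (u : R -> V) : V :=
  summability.sum (patch (fun=> 0) A u).

End function_spaces.

Section stieltjes_derivative.
Context {R : realType} {V : normedModType R}.
Implicit Types (g : R -> R) (f : R -> V).

(* Difference quotient for the derivative at a point of D_g, where the limit
   is taken from the right. *)
Definition stieltjes_quotient g f (t s : R) : V :=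
  (g s - g t)^-1 *: (f s - f t).

Definition stieltjes_derivable g f (t : R) :=
  cvg (stieltjes_quotient g f t s @[s --> t^'+]).

Definition stieltjes_derive g f (t : R) : V :=
  lim (stieltjes_quotient g f t s @[s --> t^'+]).

End stieltjes_derivative.

(* The library builds Lebesgue-Stieltjes measures from right-continuous
   functions: the measure of a left-continuous g is the one of g(x^+), which
   gives [x, y[ the mass g(y) - g(x) (see [mu_g_itv]).  The completed version
   lives on the sigma-algebra of Caratheodory-measurable sets. *)
Section stieltjes_measure.
Context {R : realType}.
Variables (g : R -> R) (g_nd : {homo g : x y / x <= y}).

Let rlimg : R -> R := rlim (g : R -> R^o).

Lemma rlim_cvg x : g s @[s --> x^'+] --> rlimg x.
Proof.
apply: nondecreasing_at_right_is_cvgr.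
  by near=> y => u v _ _; exact: g_nd.
near=> y; exists (g x) => _ [u /= + <-].
by rewrite in_itv/= => /andP[xu _]; exact/g_nd/ltW.
Unshelve. all: by end_near. Qed.

Lemma rlim_le x y : x < y -> rlimg x <= g y.
Proof.
move=> xy; apply: limr_le; first exact: rlim_cvg.
by near=> z; apply/g_nd/ltW; near: z; exact: nbhs_right_lt.
Unshelve. all: by end_near. Qed.

Lemma le_rlim x : g x <= rlimg x.
Proof.
apply: limr_ge; first exact: rlim_cvg.
by near=> z; apply/g_nd/ltW; near: z; exact: nbhs_right_gt.
Unshelve. all: by end_near. Qed.

Lemma rlim_nondecreasing : nondecreasing rlimg.
Proof.
move=> x y; rewrite le_eqVlt => /predU1P[->//|xy].
exact: le_trans (rlim_le xy) (le_rlim y).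
Qed.

Lemma rlim_right_continuous : right_continuous rlimg.
Proof.
move=> x; apply/cvgrPdist_le => e e0.
have /cvgrPdist_le/(_ e e0) := @rlim_cvg x.
move=> [d /= d0 gd]; near=> y.
have xy : x < y by near: y; exact: nbhs_right_gt.
rewrite distrC ger0_norm ?subr_ge0; last exact/rlim_nondecreasing/ltW.
pose z := (y + (x + d)) / 2.
have yd : y < x + d by near: y; apply: nbhs_right_lt; rewrite ltrDl.
have yz : y < z by rewrite midf_lt.
have zd : z < x + d by rewrite midf_lt.
have xz := lt_trans xy yz.
have := gd z; rewrite /= distrC [`|z - x|]ger0_norm ?subr_ge0 ?(ltW xz)//.
rewrite ltrBlDl zd => /(_ erefl xz).
rewrite distrC => /(le_trans (ler_norm _)); apply: le_trans.
by rewrite lerD2r rlim_le.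
Unshelve. all: by end_near. Qed.

Definition rlim_cumulative : cumulative R R :=
  HB.pack rlimg
    (isCumulative.Build R _ R rlimg rlim_nondecreasing rlim_right_continuous).

Definition mu_g := completed_lebesgue_stieltjes_measure rlim_cumulative.

HB.instance Definition _ := Measure.on mu_g.

Let mu_g_measurable_oc (x y : R) :
  (wlength rlim_cumulative)^*%mu.-cara.-measurable `]x, y]%classic.
Proof. by apply: caratheodory_measurable_mu_ext; exact: is_ocitv. Qed.

Let mu_g_oc (x y : R) : x <= y -> mu_g `]x, y]%classic = (rlimg y - rlimg x)%:E.
Proof.
move=> xy; rewrite /mu_g /completed_lebesgue_stieltjes_measure.
rewrite /completed_measure_extension measurable_mu_extE; last exact: is_ocitv.
exact: wlength_itv_bnd.
Qed.

Let mu_g_set1_measurable (x : R) :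
  (wlength rlim_cumulative)^*%mu.-cara.-measurable [set x].
Proof. by rewrite set1_bigcap_oc; apply: bigcap_measurable => // k _. Qed.

Hypothesis g_lc : forall x, g s @[s --> x^'-] --> g x.

Let rlim_cvg_left x : rlimg s @[s --> x^'-] --> g x.
Proof.
apply: (@squeeze_cvgr _ _ _ _ g (fun=> g x)) => //; last exact: cvg_cst.
near=> s; rewrite le_rlim rlim_le//.
Unshelve. all: by end_near. Qed.

Lemma mu_g_set1 (x : R) : mu_g [set x] = (rlimg x - g x)%:E.
Proof.
rewrite set1_bigcap_oc.
have /cvg_lim <- // : mu_g \o (fun k => `](x - k.+1%:R^-1)%R, x]%classic)
    @ \oo --> mu_g (\bigcap_k `](x - k.+1%:R^-1)%R, x]%classic).
  apply: nonincreasing_cvg_mu => //=.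
  - by rewrite mu_g_oc ?ltry// lerBlDr lerDl.
  - by rewrite -set1_bigcap_oc.
  - move=> m n mn; apply/subsetPset => z /=; rewrite !in_itv/= => /andP[+ ->].
    rewrite andbT; apply: le_lt_trans; rewrite lerD2l lerN2.
    by rewrite lef_pV2 ?posrE// ler_nat.
apply/cvg_lim => //.
rewrite [X in X @ \oo](_ : _ = fun k => (rlimg x - rlimg (x - k.+1%:R^-1))%:E).
  apply: cvg_EFin; first exact: nearW.
  apply: cvgB; first exact: cvg_cst.
  have /cvg_at_leftP := @rlim_cvg_left x; apply; split.
    by move=> n; rewrite ltrBlDr ltrDl.
  rewrite -[X in _ --> X]subr0; apply: cvgB; first exact: cvg_cst.
  exact: cvg_harmonic.
by apply/funext => k /=; rewrite mu_g_oc// lerBlDr lerDl.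
Qed.

Lemma mu_g_itv (x y : R) : x <= y -> mu_g `[x, y[%classic = (g y - g x)%:E.
Proof.
rewrite le_eqVlt => /predU1P[->|xy].
  by rewrite set_itvco0 measure0 subrr.
have mxy : (wlength rlim_cumulative)^*%mu.-cara.-measurable `[x, y[%classic.
  rewrite -(setDitv1r _ y false) -(setU1itv false)//; last first.
    by rewrite bnd_simp ltW.
  by apply: measurableD => //; exact: measurableU.
have : mu_g (`[x, y[%classic `|` [set y]) = mu_g ([set x] `|` `]x, y]%classic).
  by rewrite setUitv1 ?setU1itv ?bnd_simp ?ltW.
rewrite !measureU//; last 2 first.
- by apply/seteqP; split => // z [/= ->]; rewrite in_itv/= ltxx.
- by apply/seteqP; split => // z [/= + zy]; rewrite zy in_itv/= ltxx andbF.
rewrite -[X in (_ + X)%E = _]/(mu_g [set y]) -[X in _ = (X + _)%E]/(mu_g [set x]).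
rewrite -[X in _ = (_ + X)%E]/(mu_g `]x, y]%classic) -[X in (X + _)%E = _]/(mu_g `[x, y[%classic).
rewrite !mu_g_set1 mu_g_oc ?ltW//.
move=> /(congr1 (fun z => z - (rlimg y - g y)%:E)%E)/=; rewrite addeK// => ->.
rewrite -!EFinD; congr EFin; ring.
Qed.

End stieltjes_measure.
Arguments mu_g {R g} g_nd.

Definition L1 d (T : measurableType d) (R : realType) (V : normedModType R)
    (mu : {measure set T -> \bar R}) (D : set T) (h : T -> V) :=
  measurable_fun D (h : T -> g_sigma_algebraType (@open V)) /\
  (\int[mu]_(x in D) (`|h x|)%:E < +oo)%E.

(* Main.v *)
Require Import Defs.
From mathcomp Require Import all_boot all_order all_algebra.
From mathcomp Require Import complex finmap.
From mathcomp Require Import all_classical all_reals all_analysis.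
From mathcomp Require Import summability lra.

Set Implicit Arguments.
Unset Strict Implicit.
Unset Printing Implicit Defensive.
Import Order.TTheory GRing.Theory Num.Theory.
Import numFieldNormedType.Exports.
Local Open Scope classical_set_scope.
Local Open Scope ring_scope.

(* The jumps of f on [a, b[ vanish off the countable set D of jumps of g.

   (1) -> (2), (4): for B included in D let Phi_B(x) be the sum of the jumps of
   f over [a, x[ /\ B.  If the jumps are summable, all but finitely many of
   them contribute less than e in total; an interval [c, d[ over which g (or
   g^B) grows by less than the least of the finitely many remaining jumps of g
   misses all the corresponding points.  Hence Phi_B is absolutely continuous,
   so g-continuous.  Partial sums along a sequence are such functions, they
   converge uniformly by the same tail bound, and f^B is Phi_D.

   (2) -> (1): a scalar is bounded by the sum of the positive parts of finitely
   many additive functionals, so if the sum is infinite, so is the sum of the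
   positive values of one functional; enumerating the points where it is
   positive gives partial sums that are unbounded at b.

   (1) <-> (3): mu_g {t} is the jump of g at t, so the integral of |h| is the
   sum of the |Delta f(t)|. *)

(** * Completeness of the scalars and real functionals on them *)

Section scalars_theory.
Variable R : realType.

Lemma Rcomplex_Re_le (z : Rcomplex R) : `|complex.Re z| <= `|z|.
Proof.
case: z => x y; rewrite [leRHS]/Num.norm/= -sqrtr_sqr ler_sqrt ?addr_ge0 ?sqr_ge0//.
by rewrite lerDl sqr_ge0.
Qed.

Lemma Rcomplex_Im_le (z : Rcomplex R) : `|complex.Im z| <= `|z|.
Proof.
case: z => x y; rewrite [leRHS]/Num.norm/= -sqrtr_sqr ler_sqrt ?addr_ge0 ?sqr_ge0//.
by rewrite lerDr sqr_ge0.
Qed.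

Lemma Rcomplex_le_ReIm (z : Rcomplex R) :
  `|z| <= `|complex.Re z| + `|complex.Im z|.
Proof.
case: z => x y; rewrite [leLHS]/Num.norm/=.
rewrite -[leRHS]ger0_norm ?addr_ge0// -[leRHS]sqrtr_sqr.
rewrite ler_sqrt ?sqr_ge0// sqrrD !real_normK ?num_real//.
by rewrite lerD2r lerDl mulrn_wge0// mulr_ge0.
Qed.

(** The complex case reduces to the real one: real and imaginary parts are additive and do not
    increase norms, so they send Cauchy filters to Cauchy filters, and the two limits control the
    modulus. *)
Lemma scalars_cauchy_cvg F (G : set_system (scalars R F)) :
  ProperFilter G -> cauchy G -> cvg G.
Proof.
case: F G => /= G PG cG; first exact: (@cauchy_cvg R^o).
have coord (p : Rcomplex R -> R) : (forall z w, p (z - w) = p z - p w) ->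
    (forall z, `|p z| <= `|z|) -> exists l : R, p @ G --> l.
  move=> pB ple.
  suff /cauchy_cvg pG : cauchy (p @ G : set_system R^o).
    by exists (lim (p @ G : set_system R^o)); exact: pG.
  apply/cauchy_ballP => e e0.
  have /cauchy_ballP/(_ e e0) := cG.
  rewrite !near_simpl => -[[A B] [/= GA GB] AB].
  exists (p @` A, p @` B) => /=.
    by split; [apply: filterS GA => z; exists z|apply: filterS GB => z; exists z].
  move=> [_ _] [/= [z Az <-] [w Bw <-]].
  have := AB (z, w) (conj Az Bw); rewrite -!ball_normE/= -pB.
  exact: le_lt_trans.
have [x Gx] := coord _ (raddfB (@complex.Re R : Rcomplex R -> R)) Rcomplex_Re_le.
have [y Gy] := coord _ (raddfB (@complex.Im R : Rcomplex R -> R)) Rcomplex_Im_le.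
apply/cvg_ex; exists (Complex x y : Rcomplex R).
apply/cvgrPdist_lt => e e0; near=> z.
apply: le_lt_trans (Rcomplex_le_ReIm _) _; rewrite !raddfB/=.
rewrite [e]splitr ltrD//.
  by near: z; move/cvgrPdist_lt : Gx; apply; rewrite divr_gt0.
by near: z; move/cvgrPdist_lt : Gy; apply; rewrite divr_gt0.
Unshelve. all: by end_near. Qed.

(** The functionals are plus and minus the identity, or plus and minus the real and imaginary parts.
    They reduce sums of scalar norms to sums of nonnegative reals, for both fields at once. *)
Lemma scalars_functionals F : exists s : seq (scalars R F -> R),
  [/\ {in s, forall p z w, p (z + w) = p z + p w},
      {in s, forall p z, p z <= `|z|} &
      forall z, `|z| <= \sum_(p <- s) Num.max (p z) 0].
Proof.
have max_abs (x : R) : `|x| <= Num.max x 0 + Num.max (- x) 0.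
  have [x0|/ltW x0] := ger0P x.
    by rewrite -[leLHS]addr0 lerD// le_max lexx ?orbT.
  by rewrite -[leLHS]add0r lerD// le_max lexx ?orbT.
case: F => /=.
  exists [:: id; -%R]; split.
  - by move=> p; rewrite !inE => /orP[]/eqP-> z w //; rewrite opprD.
  - by move=> p; rewrite !inE => /orP[]/eqP-> z; rewrite ?ler_norm// -normrN ler_norm.
  - by move=> z; rewrite !big_cons big_nil addr0.
pose re := @complex.Re R : Rcomplex R -> R.
pose im := @complex.Im R : Rcomplex R -> R.
exists [:: re; fun z => - re z; im; fun z => - im z]; split.
- by move=> p; rewrite !inE => /or4P[]/eqP-> z w; rewrite /= ?/re ?/im raddfD ?opprD.
- move=> p; rewrite !inE => /or4P[]/eqP-> z.
  + by rewrite (le_trans (ler_norm _))// Rcomplex_Re_le.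
  + by rewrite (le_trans (ler_norm _))// normrN Rcomplex_Re_le.
  + by rewrite (le_trans (ler_norm _))// Rcomplex_Im_le.
  + by rewrite (le_trans (ler_norm _))// normrN Rcomplex_Im_le.
- move=> z; rewrite !big_cons big_nil addr0 addrA.
  by rewrite (le_trans (Rcomplex_le_ReIm _))// lerD.
Qed.

End scalars_theory.

(** * Sums of nonnegative families *)

Section esum_complements.
Context {R : realType} {T : choiceType}.
Implicit Types (A B : set T) (a : T -> \bar R).

Lemma esum_le_subset A B a : A `<=` B ->
  (\esum_(x in A) a x <= \esum_(x in B) a x)%E.
Proof.
move=> AB; apply: ge_ereal_sup => _ [X [finX XA] <-].
by apply: ereal_sup_ubound; exists X => //; split => //; exact: subset_trans AB.
Qed.

(** Some finite [B] has a sum within [e] of the supremum that defines the total; since everything is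
    finite, the sum over [B] can be subtracted. *)
Lemma esum_tail_lt A a (e : R) : (forall x, A x -> (0 <= a x)%E) ->
  (\esum_(x in A) a x < +oo)%E -> 0 < e ->
  exists B, [/\ finite_set B, B `<=` A & (\esum_(x in A `\` B) a x < e%:E)%E].
Proof.
move=> a0 aoo e0.
have afin : \esum_(x in A) a x \is a fin_num by rewrite ge0_fin_numE// esum_ge0.
have [_ [B [finB BA] <-] aB] := @ub_ereal_sup_adherent _ _ _ e0 afin.
exists B; split=> //.
have aBE : (\sum_(x \in B) a x = \esum_(x in B) a x)%E.
  by rewrite esum_fset// => x /[!inE] /BA/a0.
move: aB; rewrite aBE -/(esum A a) (esumID B)// (setIidr BA) -setDE.
have Bfin : \esum_(x in B) a x \is a fin_num.
  rewrite ge0_fin_numE ?esum_ge0//; last by move=> x /BA/a0.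
  exact: le_lt_trans (esum_le_subset _ BA) aoo.
have Dfin : \esum_(x in A `\` B) a x \is a fin_num.
  rewrite ge0_fin_numE ?esum_ge0//; last by move=> x [/a0].
  by apply: le_lt_trans aoo; apply: esum_le_subset => x [].
move: Bfin Dfin; case: (esum B a) => // r _; case: (esum (A `\` B) a) => // s _.
by rewrite -EFinD -EFinB !lte_fin; lra.
Qed.

(** [A] is the union over [n] of the sets where [a] exceeds [1/(n+1)], and each of these is finite,
    since otherwise the sum would exceed every bound. *)
Lemma esum_countable A a : (forall x, A x -> (0 < a x)%E) ->
  (\esum_(x in A) a x < +oo)%E -> countable A.
Proof.
move=> a0 aoo.
have -> : A = \bigcup_n [set x | A x /\ (n.+1%:R^-1%:E < a x)%E].
  apply/seteqP; split=> [x Ax|x [n _ []]//].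
  have := a0 _ Ax; case axE : (a x) => [r| |//] r0.
    have /= [k] := ltr_add_invr (r0 : 0 < r); rewrite add0r => kr.
    by exists k => //=; split => //; rewrite axE lte_fin.
  by exists 0%N => //=; split => //; rewrite axE ltry.
apply: bigcup_countable => // n _; apply: finite_set_countable.
apply: contrapT => infA; move: aoo; apply/negP; rewrite -leNgt leye_eq.
apply/eqP/eq_infty => M.
(* [m] exceeds [M * (n+1)], so [m] points with values at least [1/(n+1)] already sum to more than
   [M]. *)
pose m := (Num.truncn (M * n.+1%:R)).+1.
have [B BA mB] := infinite_set_fset m infA.
apply: (@le_trans _ _ (\esum_(x in [set` B]) a x)); last first.
  by apply: esum_le_subset => x /BA[].
have {}BA x : x \in B -> (n.+1%:R^-1%:E <= a x)%E by move=> /BA[_ /ltW].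
rewrite esum_fset//; last first.
  by move=> x /set_mem/= /BA; apply: le_trans; rewrite lee_fin invr_ge0.
rewrite fsbig_finite//= set_fsetK.
apply: (@le_trans _ _ (\sum_(x <- B) n.+1%:R^-1%:E)%E); last first.
  by rewrite big_seq [leRHS]big_seq; apply: lee_sum => x /BA.
rewrite sumEFin lee_fin big_const_seq count_predT iter_addr_0.
rewrite -[leRHS]mulr_natr mulrC ler_pdivlMr//.
apply: (@le_trans _ _ m%:R); last by rewrite ler_nat.
exact/ltW/truncnS_gt.
Qed.

End esum_complements.

(** * Unordered sums of scalars *)

Section unordered_sums.
Context {R : realType} {F : scalar_field}.
Notation V := (scalars R F).
#[local] Existing Instance totally_filter.
Implicit Types (A B : set R) (u : R -> V).

Lemma norm_fsbig_le_esum A u : finite_set A ->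
  ((`|\sum_(x \in A) u x|)%:E <= \esum_(x in A) (`|u x|)%:E)%E.
Proof.
move=> finA; rewrite esum_fset// !fsbig_finite//= sumEFin lee_fin.
exact: ler_norm_sum.
Qed.

Lemma partial_sum_fsbig u (X : {fset R}) :
  partial_sum u X = \sum_(x \in [set` X]) u x.
Proof. by rewrite /partial_sum fsbig_finite//= set_fsetK big_seq_fsetE. Qed.

Lemma esum_norm_patch A B u :
  \esum_(x in B) (`|patch (fun=> 0) A u x|)%:E = \esum_(x in A `&` B) (`|u x|)%:E.
Proof.
rewrite esum_mkcondl; apply: eq_esum => x _; rewrite /patch.
by case: ifPn => // _; rewrite normr0.
Qed.

(** Cauchy criterion: once a finite index set contains a [B] whose complement in [A] carries less
    than [e], its partial sum is within [e] of the sum over [B]. Completeness then gives the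
    limit. *)
Lemma cvg_unordered_sum A u : abs_summable A u ->
  partial_sum (patch (fun=> 0) A u) @ totally --> unordered_sum A u.
Proof.
move=> Au; apply: scalars_cauchy_cvg; apply: (cauchy_exP (R := R)) => e e0.
have [//|B [finB BA tailB]] := esum_tail_lt _ Au e0.
pose w := patch (fun=> 0) A u.
exists (\sum_(x \in B) w x), (fset_set B) => // X /= BX.
rewrite -ball_normE/= partial_sum_fsbig.
have {}BX : B `<=` [set` X].
  by move=> x Bx; apply: (fsubsetP BX); rewrite in_fset_set// inE.
rewrite [X in _ - X](fsbigID B)//= (setIidr BX) opprD addrA subrr sub0r normrN -lte_fin.
apply: le_lt_trans (norm_fsbig_le_esum _ _) _.
  exact: finite_setIl.
rewrite esum_norm_patch; apply: le_lt_trans tailB.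
by apply: esum_le_subset => x [Ax [_ Bx]].
Qed.

Lemma eq_unordered_sum A B u :
  (forall x, B x -> A x) -> (forall x, A x -> ~ B x -> u x = 0) ->
  unordered_sum A u = unordered_sum B u.
Proof.
move=> BA ABu; congr summability.sum; apply/funext => x; rewrite /patch.
case: ifPn => [/set_mem Ax|/negP nAx]; case: ifPn => //.
  by move=> /negP nBx; apply: ABu => // /mem_set.
by move=> /set_mem/BA Ax; exfalso; apply: nAx; exact: mem_set.
Qed.

Lemma unordered_sumU A B u : A `&` B = set0 ->
  abs_summable (A `|` B) u ->
  unordered_sum (A `|` B) u = unordered_sum A u + unordered_sum B u.
Proof.
move=> AB0 ABu.
have Au : abs_summable A u by apply: le_lt_trans ABu; exact: esum_le_subset.
have Bu : abs_summable B u by apply: le_lt_trans ABu; exact: esum_le_subset.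
apply: cvg_unique (cvg_unordered_sum ABu) _ => //.
have -> : partial_sum (patch (fun=> 0) (A `|` B) u) =
    partial_sum (patch (fun=> 0) A u) \+ partial_sum (patch (fun=> 0) B u).
  apply/funext => X; rewrite /partial_sum /= -big_split/=.
  apply: eq_bigr => i _; rewrite /patch in_setU.
  have [iA|iA] := boolP (_ \in A); have [iB|iB] := boolP (_ \in B);
    rewrite ?addr0 ?add0r//=.
  have : (A `&` B) (val i) by split; exact: set_mem.
  by rewrite AB0.
exact: cvgD (cvg_unordered_sum Au) (cvg_unordered_sum Bu).
Qed.

Lemma norm_unordered_sum_le A u : abs_summable A u ->
  ((`|unordered_sum A u|)%:E <= \esum_(x in A) (`|u x|)%:E)%E.
Proof.
move=> Au.
have Afin : \esum_(x in A) (`|u x|)%:E \is a fin_num.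
  by rewrite ge0_fin_numE// esum_ge0.
rewrite -(fineK Afin) lee_fin.
have cn : `|partial_sum (patch (fun=> 0) A u) X| @[X --> totally] -->
    `|unordered_sum A u|.
  exact: cvg_norm (cvg_unordered_sum Au).
rewrite -(cvg_lim _ cn)//; apply: limr_le; first by apply/cvg_ex; eexists; exact: cn.
apply: nearW => X; rewrite -lee_fin fineK// partial_sum_fsbig.
apply: le_trans (norm_fsbig_le_esum _ _) _ => //.
by rewrite esum_norm_patch; apply: esum_le_subset.
Qed.

Lemma unordered_sum0 u : unordered_sum set0 u = 0.
Proof.
apply/eqP; rewrite -normr_le0 -lee_fin.
apply: le_trans (norm_unordered_sum_le _) _; rewrite /abs_summable esum_set0//.
Qed.

Lemma unordered_sum1 u x : unordered_sum [set x] u = u x.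
Proof.
have xu : abs_summable [set x] u by rewrite /abs_summable esum_set1// ltry.
apply: cvg_unique (cvg_unordered_sum xu) _ => //.
apply: cvg_near_cst; exists [fset x]%fset => // X /= xX.
rewrite partial_sum_fsbig; apply/eqP.
have xX' : [set x] `<=` [set` X] by move=> _ ->; apply: (fsubsetP xX); rewrite inE.
rewrite (fsbigID [set x])//= setIidr// fsbig_set1 patchT ?inE// fsbig1 ?addr0//.
by move=> y [_ /= yx]; rewrite patchN//; apply/negP => /set_mem.
Qed.

End unordered_sums.

(** * Integrals over countable sets *)

Section countable_integral.
Context d (T : measurableType d) {R : realType}.
Hypothesis measurable_singleton : forall x : T, measurable [set x].

Lemma countable_measurable_fun d' (T' : sigmaRingType d') (A : set T)
    (f : T -> T') : countable A -> measurable_fun A f.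
Proof.
move=> cA _ Y mY; apply: countable_measurable => //.
by apply: sub_countable cA; apply: subset_card_le => x [].
Qed.

Lemma countable_integral (mu : {measure set T -> \bar R}) (A : set T)
    (f : T -> \bar R) : countable A -> (forall x, A x -> (0 <= f x)%E) ->
  (\int[mu]_(x in A) f x = \esum_(x in A) (f x * mu [set x]))%E.
Proof.
move=> cA f0; have /countable_injP[i i_inj] := cA.
(* The fibres of an injection into the naturals are empty or singletons, so countable additivity of
   the integral gives the sum over points. *)
pose F k := A `&` [set x | i x = k].
have AF : A = \bigcup_k F k.
  by apply/seteqP; split=> [x Ax|x [k _ []]//]; exists (i x).
have tF : trivIset setT F by move=> k l _ _ [x [[_ <-] [_ <-]]].
have mF k : measurable (F k).
  apply: countable_measurable => //; apply: sub_countable cA.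
  by apply: subset_card_le => x [].
(* Extension by zero makes the integrand nonnegative everywhere, not only on [A]. *)
pose f' x := if x \in A then f x else 0%E.
have f'0 x : (0 <= f' x)%E by rewrite /f'; case: ifPn => // /set_mem /f0.
have f'E x : A x -> f x = f' x by move=> Ax; rewrite /f' mem_set.
transitivity (\int[mu]_(x in A) f' x)%E.
  by apply: eq_integral => x /set_mem /f'E.
transitivity (\esum_(x in A) (f' x * mu [set x]))%E; last first.
  by apply: eq_esum => x /f'E ->.
rewrite AF ge0_integral_bigcup//; last by rewrite -AF; exact: countable_measurable_fun.
rewrite nneseries_sum_bigcup//; last by move=> x; exact: mule_ge0.
apply: eq_eseriesr => k _.
have [->|/set0P[x Fx]] := eqVneq (F k) set0; first by rewrite integral_set0 esum_set0.
have -> : F k = [set x].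
  apply/seteqP; split=> [y Fy|_ ->//]; apply: i_inj; rewrite ?inE; first exact: Fy.1.
    exact: Fx.1.
  by rewrite Fy.2 Fx.2.
rewrite esum_set1 ?mule_ge0// -(integral_cst mu (measurable_singleton x)).
by apply: eq_integral => y /set_mem ->.
Qed.

End countable_integral.

(** * Jumps of [g] and its jump part *)

Section jumps_of_g.
Context {R : realType} {g : R -> R}.
Hypothesis g_nd : {homo g : x y / x <= y}.
Hypothesis g_lc : forall x, g s @[s --> x^'-] --> g x.

Notation jumpg := (jump (g : R -> R^o)).
Notation mu_gT := (caratheodory_type (wlength (rlim_cumulative g_nd))^*%mu).

Lemma jump_ge0 s : 0 <= jumpg s.
Proof. by rewrite subr_ge0 le_rlim. Qed.

Lemma jump_le c s e : c <= s -> s < e -> jumpg s <= g e - g c.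
Proof. by move=> cs se; rewrite lerB ?rlim_le// g_nd. Qed.

Lemma jump_eq0 s : ~ jump_set g s -> jumpg s = 0.
Proof.
move=> /negP; rewrite -leNgt => js; apply/eqP.
by rewrite eq_le js jump_ge0.
Qed.

Lemma mu_g_measurable_itvoc (x y : R) :
  measurable (`]x, y]%classic : set mu_gT).
Proof. by apply: caratheodory_measurable_mu_ext; exact: is_ocitv. Qed.

Lemma mu_g_measurable_set1 (x : R) :
  measurable ([set x] : set mu_gT).
Proof.
rewrite (set1_bigcap_oc x); apply: bigcap_measurable => // k _.
exact: mu_g_measurable_itvoc.
Qed.

Lemma mu_g_measurable_itvcc (x y : R) : x <= y ->
  measurable (`[x, y]%classic : set mu_gT).
Proof.
move=> xy; rewrite -(setU1itv false)//; apply: measurableU.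
  exact: mu_g_measurable_set1.
exact: mu_g_measurable_itvoc.
Qed.

Lemma mu_g_measurable_itvco (x y : R) : x <= y ->
  measurable (`[x, y[%classic : set mu_gT).
Proof.
move=> xy; rewrite -(setDitv1r _ y false); apply: measurableD.
  exact: mu_g_measurable_itvcc.
exact: mu_g_measurable_set1.
Qed.

(** On a finite subset [X] of the interval the jumps add up to the [mu_g]-measure of [X], which is
    at most that of the interval. *)
Lemma esum_jump_le x y : x <= y ->
  (\esum_(s in `[x, y[) (jumpg s)%:E <= (g y - g x)%:E)%E.
Proof.
move=> xy; apply: ge_ereal_sup => _ [X [finX Xxy] <-].
rewrite -(mu_g_itv g_nd g_lc xy) -esum_fset//; last first.
  by move=> s _; rewrite lee_fin jump_ge0.
have -> : \esum_(s in X) (jumpg s)%:E =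
    (\int[mu_g g_nd]_(s in X) 1)%E.
  rewrite countable_integral//; [|exact: mu_g_measurable_set1|exact: finite_set_countable].
  by apply: eq_esum => s _; rewrite mul1e; have := mu_g_set1 g_nd g_lc s.
rewrite integral_cst ?mul1e; last first.
  apply: countable_measurable; first exact: mu_g_measurable_set1.
  exact: finite_set_countable.
apply: le_measure => //; rewrite inE.
  apply: countable_measurable; first exact: mu_g_measurable_set1.
  exact: finite_set_countable.
exact: mu_g_measurable_itvco.
Qed.

(** The jumps at these points are positive and their sum is bounded by the growth of [g]. *)
Lemma jump_set_itv_countable x y : countable (jump_set g `&` `[x, y[).
Proof.
have [xy|yx] := leP x y; last first.
  by rewrite set_itv_ge ?setI0 ?bnd_simp -?ltNge// ltNge ltW.
apply: (esum_countable (a := fun s => (jumpg s)%:E)) => [s []//|].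
apply: le_lt_trans (ltry (g y - g x)); apply: le_trans (esum_jump_le xy).
exact: esum_le_subset.
Qed.

Let J x y := fine (\esum_(s in `[x, y[ `&` jump_set g) (jumpg s)%:E).

Let J_fin x y : x <= y ->
  \esum_(s in `[x, y[ `&` jump_set g) (jumpg s)%:E \is a fin_num.
Proof.
move=> xy; rewrite ge0_fin_numE; last first.
  by apply: esum_ge0 => s _; rewrite lee_fin jump_ge0.
apply: le_lt_trans (ltry (g y - g x)); apply: le_trans (esum_jump_le xy).
exact: esum_le_subset.
Qed.

Let J_add x y z : x <= y -> y <= z -> J x z = J x y + J y z.
Proof.
move=> xy yz; rewrite /J -fineD ?J_fin//; congr fine.
rewrite (esumID `[x, y[); last by move=> s _; rewrite lee_fin jump_ge0.
congr (_ + _)%E; congr esum; apply/seteqP; split=> s /=; rewrite !in_itv/=.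
- by move=> [[_ ?]].
- move=> [/andP[xs sy] Ds]; split; last exact/andP.
  by rewrite xs (lt_le_trans sy yz).
- by move=> [[/andP[xs ->] ?]] /negP; rewrite xs/= -leNgt => ->.
- move=> [/andP[ys ->] Ds]; rewrite (le_trans xy ys); split => //.
  by rewrite ltNge ys.
Qed.

Let Jxx x : J x x = 0.
Proof. by rewrite /J set_itvco0 set0I esum_set0. Qed.

(** The definition of [jump_part] branches at 0; additivity of [J] over adjacent intervals joins the
    branches, according to the signs of [c] and [e]. *)
Lemma jump_part_sub c e : c <= e ->
  jump_part g e - jump_part g c =
  fine (\esum_(s in `[c, e[ `&` jump_set g) (jumpg s)%:E).
Proof.
move=> ce; rewrite /jump_part -!/(J _ _).
case: ltP => e0; case: ltP => c0.
- by rewrite (J_add (ltW c0) ce) addrAC subrr add0r.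
- by rewrite opprK addrC -J_add// ltW.
- by move: (lt_le_trans c0 ce); rewrite ltNge e0.
- by rewrite opprK addrC (J_add ce e0) addrK.
Qed.

Lemma jump_le_jump_part c s e : jump_set g s -> c <= s -> s < e ->
  jumpg s <= jump_part g e - jump_part g c.
Proof.
move=> Ds cs se; have ce := ltW (le_lt_trans cs se).
rewrite jump_part_sub// -lee_fin fineK ?J_fin//.
rewrite -(@esum_set1 _ _ s (fun s => (jumpg s)%:E)) ?lee_fin ?jump_ge0//.
by apply: esum_le_subset => _ ->; split => //=; rewrite in_itv/= cs.
Qed.

Lemma cvg_right_notin_jump_set s : ~ jump_set g s -> g x @[x --> s^'+] --> g s.
Proof.
move=> /jump_eq0/eqP; rewrite subr_eq0 => /eqP <-.
exact: rlim_cvg.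
Qed.

End jumps_of_g.

(** * Finite minima, disjoint families and absolute continuity *)

Lemma finite_set_lower_bound {R : realType} {T : choiceType} (A : set T)
    (v : T -> R) : finite_set A -> (forall x, A x -> 0 < v x) ->
  exists2 e, 0 < e & forall x, A x -> e <= v x.
Proof.
move=> finA v0; have /finite_seqP[s As] := finA.
(* The initial value 1 keeps the bound positive when [A] is empty. *)
exists (\big[Num.min/1]_(x <- s) v x).
  by rewrite big_seq lt_bigmin// => x xs; apply: v0; rewrite As.
by move=> x; rewrite As/= => xs; exact: ge_bigmin_seq.
Qed.

(** After the two sums are exchanged, each [v x] is counted at most once, because [x] lies in at
    most one [J i]. *)
Lemma sum_esum_disjoint_le {R : realType} {T : choiceType} (I : finType)
    (A : set T) (J : I -> set T) (v : T -> \bar R) :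
  (forall x, A x -> 0 <= v x)%E -> trivIset setT J ->
  (\sum_i \esum_(x in A `&` J i) v x <= \esum_(x in A) v x)%E.
Proof.
move=> v0 tJ.
under eq_bigr do rewrite esum_mkcondr.
rewrite -esum_sum; last by move=> x i Ax _; case: ifPn => // _; exact: v0.
apply: le_esum => x Ax.
have [[i Jix]|nJ] := pselect (exists i, J i x); last first.
  rewrite big1 ?v0// => i _; case: ifPn => // /set_mem Jix.
  by exfalso; apply: nJ; exists i.
rewrite (bigD1 i)//= mem_set// big1 ?adde0// => j ji.
case: ifPn => // /set_mem Jjx; move/eqP : ji => [].
by apply: tJ => //; exists x.
Qed.

(** A common point [x] of two half-open intervals yields a common point of the open ones: the
    midpoint of [x] and the smaller right end. The left ends matter because the increment of a step
    function from [c] to [d] counts the jump at [c]. *)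
Lemma trivIset_itvco {R : realType} (I : Type) (c d : I -> R) :
  trivIset setT (fun i => [set` `]c i, d i[]) ->
  trivIset setT (fun i => [set` `[c i, d i[]).
Proof.
move=> tcd i j _ _ [x [/=]]; rewrite !in_itv/= => /andP[ci di] /andP[cj dj].
apply: tcd => //; exists ((x + Num.min (d i) (d j)) / 2).
have xm : x < Num.min (d i) (d j) by rewrite lt_min di.
have [mi mj] : Num.min (d i) (d j) <= d i /\ Num.min (d i) (d j) <= d j.
  by rewrite !ge_min !lexx orbT.
by split; rewrite /= in_itv/=; apply/andP; split; lra.
Qed.

(** Absolute continuity is applied to the single interval between [t] and [s]. *)
Lemma abs_cont_g_continuous {R : realType} {V : normedModType R}
    (g : R -> R) a b (f : R -> V) : abs_cont g a b f -> g_continuous g a b f.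
Proof.
move=> fAC t; rewrite in_itv/= => /andP[at_ tb] e e0.
have [d d0 fd] := fAC e e0; exists d => // s; rewrite in_itv/= => /andP[as_ sb].
have step c h : a <= c -> c < h -> h <= b -> g h - g c < d -> `|f h - f c| < e.
  move=> ac ch hb gd; have := fd 1%N (fun=> c) (fun=> h).
  rewrite !big_ord1; apply => //.
  by move=> i j _ _ _; rewrite !ord1.
move=> gts; have [ts|st|->] := ltgtP t s; last by rewrite subrr normr0.
  rewrite distrC; apply: step => //; apply: le_lt_trans gts.
  by rewrite distrC ler_norm.
by apply: step => //; apply: le_lt_trans gts; rewrite ler_norm.
Qed.

(** * Step functions with jumps in a subset of [D] *)

Section step_functions.
Context {R : realType} {F : scalar_field}.
Notation V := (scalars R F).
Variables (g : R -> R) (a b : R) (B : set R) (u : R -> V).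
Hypothesis BD : B `<=` jump_set g `&` `[a, b[.
Hypothesis Bu : abs_summable B u.

(** This is [Phi_B] with a general [u]. For [u] the jumps of [f], [B = D] gives the jump part of [f]
    on [[a, b]], and the image of an initial segment of a sequence gives a partial sum of condition
    2. *)
Definition step_fun x : V := unordered_sum (`[a, x[ `&` B) u.

Let abs_summable_sub A : A `<=` B -> abs_summable A u.
Proof. by move=> AB; apply: le_lt_trans Bu; exact: esum_le_subset. Qed.

Lemma step_fun_sub c e : a <= c -> c <= e ->
  step_fun e - step_fun c = unordered_sum (`[c, e[ `&` B) u.
Proof.
move=> ac ce; apply/eqP; rewrite subr_eq addrC /step_fun -unordered_sumU.
- apply/eqP; congr unordered_sum; rewrite -setIUl; congr (_ `&` _).
  apply/seteqP; split=> s /=; rewrite !in_itv/=.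
    by move=> /andP[-> se]; rewrite se andbT; case: ltP; [left|right].
  move=> [/andP[-> sc]|/andP[cs ->]]; first by rewrite (lt_le_trans sc).
  by rewrite (le_trans ac).
- apply/seteqP; split=> // s [[/=]]; rewrite in_itv/= => /andP[_ sc] _ [/=].
  by rewrite in_itv/= leNgt sc.
- by apply: abs_summable_sub => s [] [].
Qed.

Lemma norm_step_fun_sub_le c e : a <= c -> c <= e ->
  ((`|step_fun e - step_fun c|)%:E <= \esum_(s in B `&` `[c, e[) (`|u s|)%:E)%E.
Proof.
move=> ac ce; rewrite step_fun_sub// setIC; apply: norm_unordered_sum_le.
by apply: abs_summable_sub => s [].
Qed.

(* k is g or its jump part. *)
Lemma step_fun_abs_cont (k : R -> R) : {homo k : x y / x <= y} ->
  (forall c s e, B s -> c <= s -> s < e ->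
    jump (g : R -> R^o) s <= k e - k c) ->
  abs_cont k a b step_fun.
Proof.
move=> k_nd k_jump e e0.
have [//|A [finA AB tailA]] := esum_tail_lt _ Bu e0.
(* [d] is a positive lower bound for the jumps of [g] on the finite set [A] outside which [u] has
   total norm less than [e]. *)
have [s /AB/BD[]//|d d0 dA] :=
  @finite_set_lower_bound R _ A (jump (g : R -> R^o)) finA.
exists d => // m c h abch /trivIset_itvco tch sum_lt.
(* A point of [A] in one interval would make [k] grow by at least [d] there; the other increments
   are nonnegative, so the total could not be below [d]. *)
have noA n s : `[c n, h n[%classic s -> ~ A s.
  rewrite /= in_itv/= => /andP[cs sh] As.
  have := lt_le_trans sum_lt (dA s As); apply/negP; rewrite -leNgt.
  apply: le_trans (k_jump _ _ _ (AB _ As) cs sh) _.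
  rewrite (bigD1 n)//= lerDl sumr_ge0// => j _.
  by rewrite subr_ge0 k_nd//; have [_ /ltW] := abch j.
rewrite -lte_fin -sumEFin; apply: le_lt_trans tailA.
apply: le_trans (sum_esum_disjoint_le _ tch) => //.
apply: lee_sum => n _; have [an cn hn] := abch n.
apply: le_trans (norm_step_fun_sub_le an (ltW cn)) _.
by apply: esum_le_subset => s [Bs ns]; split=> //; split=> //; exact: noA ns.
Qed.

Lemma norm_step_fun_le x : `|step_fun x| <= fine (\esum_(s in B) (`|u s|)%:E).
Proof.
rewrite -lee_fin fineK; last by rewrite ge0_fin_numE// esum_ge0.
apply: le_trans (norm_unordered_sum_le _) _.
  by apply: abs_summable_sub => s [].
exact: esum_le_subset.
Qed.

Lemma step_fun_BCg : {homo g : x y / x <= y} -> BCg g a b step_fun.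
Proof.
move=> g_nd; split.
  by exists (fine (\esum_(s in B) (`|u s|)%:E)) => t _; exact: norm_step_fun_le.
apply: abs_cont_g_continuous; apply: step_fun_abs_cont => // c s e _.
exact: jump_le.
Qed.

Lemma step_fun_cvg_right t : a <= t ->
  step_fun s @[s --> t^'+] --> step_fun t + unordered_sum ([set t] `&` B) u.
Proof.
move=> at_; apply/cvgrPdist_lt => e e0.
have [//|A [finA AB tailA]] := esum_tail_lt _ Bu e0.
(* [d] bounds from below the distance from [t] to the points of [A] on its right, so []t, s[] misses
   [A] when [s < t + d]. The value 1 at the other points is a positive placeholder. *)
have [s _|d d0 dA] := @finite_set_lower_bound R _ A
    (fun s => if s <= t then 1 else s - t) finA.
  by case: (leP s t) => // ts; rewrite subr_gt0.
near=> s.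
have ts : t < s by near: s; exact: nbhs_right_gt.
have sd : s < t + d by near: s; apply: nbhs_right_lt; rewrite ltrDl.
rewrite distrC opprD addrA (step_fun_sub at_ (ltW ts)).
have -> : `[t, s[ `&` B = ([set t] `&` B) `|` (`]t, s[ `&` B).
  by rewrite -setIUl setU1itv// bnd_simp.
rewrite unordered_sumU; last 2 first.
- by apply/seteqP; split=> // x [[-> _] [/=]]; rewrite in_itv/= ltxx.
- by apply: abs_summable_sub => x [] [].
rewrite addrAC subrr add0r -lte_fin.
apply: le_lt_trans (norm_unordered_sum_le _) _.
  by apply: abs_summable_sub => x [].
apply: le_lt_trans tailA; apply: esum_le_subset => x [/=].
rewrite in_itv/= => /andP[tx xs] Bx; split => // /dA.
by case: (leP x t) => [xt|_]; [move: (lt_le_trans tx xt); rewrite ltxx|lra].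
Unshelve. all: by end_near. Qed.

End step_functions.

(** Induction on [n]: by injectivity [t n] is a new point, and it contributes exactly when it lies
    to the left of [x]. *)
Lemma step_fun_image {R : realType} {F : scalar_field} (a : R)
    (u : R -> scalars R F) (t : nat -> R) n x :
  injective t -> (forall k, a <= t k) ->
  abs_summable (range t) u ->
  step_fun a (t @` `I_n) u x = \sum_(0 <= k < n | t k < x) u (t k).
Proof.
move=> t_inj at_ tu; elim: n => [|n IHn].
  by rewrite big_geq// /step_fun II0 image_set0 setI0 unordered_sum0.
rewrite big_mkcond big_nat_recr//= -big_mkcond/= -IHn /step_fun IIS.
rewrite image_setU image_set1 setIUr unordered_sumU; last 2 first.
- apply/seteqP; split=> // y [[_ [k /= kn <-]] [_ /= /t_inj kE]].
  by rewrite kE ltnn in kn.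
- apply: le_lt_trans tu; apply: esum_le_subset => y [[_ [k _ <-]]|[_ ->]];
    by eexists.
congr (_ + _); case: ifPn => tx.
  rewrite (_ : _ `&` _ = [set t n]) ?unordered_sum1//.
  by apply/seteqP; split=> [y []//|_ ->]; split => //=; rewrite in_itv/= at_.
rewrite (_ : _ `&` _ = set0) ?unordered_sum0//.
apply/seteqP; split=> // y [/[swap]] -> /=.
by rewrite in_itv/= (negbTE tx) andbF.
Qed.

(** * The sup norm and bounded [g]-continuous functions *)

Section bounded_g_continuous.
Context {R : realType} {V : normedModType R}.
Variables (g : R -> R) (a b : R).
Hypothesis ab : a < b.
Implicit Types f : R -> V.

Lemma sup_norm_itv f M : (forall t, t \in `[a, b] -> `|f t| <= M) ->
  0 <= sup_norm a b f <= M.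
Proof.
move=> fM; have aab : a \in `[a, b] by rewrite in_itv/= lexx ltW.
apply/andP; split.
  apply: le_trans (normr_ge0 (f a)) _; apply: ub_le_sup; last by exists a.
  by exists M => _ [t tab <-]; exact: fM.
apply: ge_sup; first by exists `|f a|, a.
by move=> _ [t tab <-]; exact: fM.
Qed.

Lemma le_sup_norm f t : bounded_itv a b f -> t \in `[a, b] ->
  `|f t| <= sup_norm a b f.
Proof.
move=> [M fM] tab; apply: ub_le_sup; last by exists t.
by exists M => _ [s sab <-]; exact: fM.
Qed.

Lemma bounded_itvB f1 f2 : bounded_itv a b f1 -> bounded_itv a b f2 ->
  bounded_itv a b (f1 \- f2).
Proof.
move=> [M1 f1M] [M2 f2M]; exists (M1 + M2) => t tab /=.
by rewrite (le_trans (ler_normB _ _))// lerD ?f1M ?f2M.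
Qed.

Lemma BCgB f1 f2 : BCg g a b f1 -> BCg g a b f2 -> BCg g a b (f1 \- f2).
Proof.
move=> [bf1 cf1] [bf2 cf2]; split; first exact: bounded_itvB.
move=> t tab e e0; have e20 : 0 < e / 2 by rewrite divr_gt0.
have [d1 d10 f1d] := cf1 _ tab _ e20; have [d2 d20 f2d] := cf2 _ tab _ e20.
exists (Num.min d1 d2); first by rewrite lt_min d10.
move=> s sab; rewrite lt_min => /andP[gd1 gd2] /=.
rewrite opprD addrACA -opprD [e]splitr (le_lt_trans (ler_normB _ _))//.
by rewrite ltrD// ?f1d ?f2d.
Qed.

Lemma BCg_eq f1 f2 : {in `[a, b], f1 =1 f2} -> BCg g a b f1 -> BCg g a b f2.
Proof.
move=> f12 [[M f1M] cf1]; split; first by exists M => t tab; rewrite -f12 ?f1M.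
move=> t tab e e0; have [d d0 fd] := cf1 t tab e e0.
by exists d => // s sab gd; rewrite -!f12//; exact: fd.
Qed.

Lemma abs_cont_eq (k : R -> R) f1 f2 : {in `[a, b], f1 =1 f2} ->
  abs_cont k a b f1 -> abs_cont k a b f2.
Proof.
move=> f12 AC e e0; have [d d0 fd] := AC e e0.
exists d => // m c h abch tch sd.
apply: le_lt_trans (fd _ _ _ abch tch sd); apply/ler_sum => n _.
have [ac ch hb] := abch n.
by rewrite !f12// in_itv/= ?hb ?ac/= ?andbT ltW// ?(le_lt_trans ac)// (lt_le_trans ch).
Qed.

Lemma BC_eq f1 f2 : {in `[a, b], f1 =1 f2} -> BC a b f1 -> BC a b f2.
Proof.
move=> f12 [[M f1M] cf1]; split; first by exists M => t tab; rewrite -f12 ?f1M.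
by apply: subspace_eq_continuous cf1 => t /set_mem; exact: f12.
Qed.

(** One-sided continuity of [g] at [t] passes to [f]: it serves on the right at points where [g]
    does not jump, and on the left at every point. *)
Lemma g_continuous_cvg f t (G : set_system R) {FG : Filter G} :
  g_continuous g a b f -> t \in `[a, b] ->
  g s @[s --> G] --> g t -> (\forall s \near G, s \in `[a, b]) ->
  f s @[s --> G] --> f t.
Proof.
move=> fc tab Gg Gab; apply/cvgrPdist_lt => e e0.
have [d d0 fd] := fc t tab e e0.
near=> s; apply: fd; first by near: s.
by near: s; move/cvgrPdist_lt : Gg; exact.
Unshelve. all: by end_near. Qed.

End bounded_g_continuous.

(** A preimage is a countable set together with either all of [E] outside [A] or none of it,
    according to whether [Y] contains the default value [c]. *)
Lemma countable_patch_measurable d (T : measurableType d) d'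
    (T' : sigmaRingType d') (E A : set T) (c : T') (f : T -> T') :
  (forall x : T, measurable [set x]) -> measurable E -> countable A ->
  measurable_fun E (patch (fun=> c) A f).
Proof.
move=> m1 mE cA _ Y mY.
have -> : E `&` patch (fun=> c) A f @^-1` Y =
    (E `&` (A `&` f @^-1` Y)) `|` ((E `\` A) `&` [set _ | Y c]).
  apply/seteqP; split=> x /=; rewrite /patch.
    move=> [Ex]; case: ifPn => [/set_mem Ax Yf|/negP nAx Yc]; first by left.
    by right; split => //; split => // Ax; apply: nAx; exact: mem_set.
  move=> [[Ex [Ax Yf]]|[[Ex nAx] Yc]]; split => //; first by rewrite mem_set.
  by rewrite memNset.
have cmeas (B : set T) : B `<=` A -> measurable B.
  move=> BA; apply: countable_measurable => //; apply: sub_countable cA.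
  exact: subset_card_le.
apply: measurableU; first by apply: cmeas => x [_ []].
apply: measurableI.
  by apply: measurableD => //; exact: cmeas.
have [Yc|nYc] := pselect (Y c).
  by rewrite (_ : [set _ | _] = setT)//; apply/seteqP; split.
by rewrite (_ : [set _ | _] = set0)//; apply/seteqP; split.
Qed.

(** * Decomposition of [f], and integrability of its Stieltjes derivative *)

Section equivalences.
Context {R : realType} {F : scalar_field}.
Notation V := (scalars R F).
Variables (a b : R) (g : R -> R) (f : R -> V).
Hypothesis ab : a < b.
Hypothesis g_nd : {homo g : x y / x <= y}.
Hypothesis g_lc : forall x, g s @[s --> x^'-] --> g x.
Hypothesis f_BCg : BCg g a b f.
Hypothesis f_rlim :
  forall t, (jump_set g `&` `[a, b[) t -> cvg (f s @[s --> t^'+]).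

Notation D := (jump_set g `&` `[a, b[).
Notation fB := (fun t => unordered_sum `[a, t[ (jump f)).
Notation stepD := (step_fun a D (jump f)).
Let jumps_summable := (\esum_(t in D) (`|jump f t|)%:E < +oo)%E.

Lemma cvg_right_notin_D t : t \in `[a, b[ -> ~ jump_set g t ->
  f s @[s --> t^'+] --> f t.
Proof.
rewrite in_itv/= => /andP[at_ tb] Dt; apply: (g_continuous_cvg f_BCg.2).
- by rewrite in_itv/= at_ ltW.
- exact: cvg_right_notin_jump_set.
- near=> s; rewrite in_itv/=; apply/andP; split.
    by apply: (le_trans at_); near: s; exact: nbhs_right_ge.
  by near: s; exact: nbhs_right_le.
Unshelve. all: by end_near. Qed.

Lemma is_cvg_right_itvco t : t \in `[a, b[ -> cvg (f s @[s --> t^'+]).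
Proof.
move=> tab; have [Dt|Dt] := pselect (jump_set g t); first exact: f_rlim.
by apply/cvg_ex; exists (f t); exact: cvg_right_notin_D.
Qed.

Lemma jump_notin_D t : t \in `[a, b[ -> ~ D t -> jump f t = 0.
Proof.
move=> tab Dt; apply/eqP; rewrite subr_eq0; apply/eqP/cvg_lim => //.
by apply: cvg_right_notin_D => // Dgt; exact: Dt.
Qed.

Lemma cvg_right_jump t : t \in `[a, b[ ->
  f s @[s --> t^'+] --> f t + jump f t.
Proof. by move=> /is_cvg_right_itvco; rewrite addrC subrK. Qed.

(** The jumps of [f] vanish off [D], so the extra indices add nothing. *)
Lemma unordered_sum_jumpE : {in `[a, b], stepD =1 fB}.
Proof.
move=> t; rewrite in_itv/= => /andP[at_ tb]; apply/esym/eq_unordered_sum.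
  by move=> s [].
move=> s sat nDs; have sab : s \in `[a, b[.
  by move: sat; rewrite /= !in_itv/= => /andP[-> /lt_le_trans]; exact.
by apply: jump_notin_D => // Ds; apply: nDs.
Qed.

Lemma abs_summable_jump t : t \in `[a, b] -> jumps_summable ->
  abs_summable `[a, t[ (jump f).
Proof.
rewrite in_itv/= => /andP[at_ tb]; apply: le_lt_trans.
rewrite esum_mkcond [leRHS]esum_mkcond; apply: le_esum => s _.
case: ifPn => [/set_mem sat|_]; case: ifPn => // /negP nDs.
rewrite jump_notin_D ?normr0//; last by move=> /mem_set.
by move: sat; rewrite /= !in_itv/= => /andP[-> /lt_le_trans]; exact.
Qed.

(** On the right of [t], both [f] and [stepD] jump by the same amount and the jumps cancel; on the
    left, the difference is [g]-continuous and [g] is left continuous. *)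
Lemma continuous_part_BC : jumps_summable -> BC a b (f \- stepD).
Proof.
move=> Ds; have DD : D `<=` D by [].
have step_BCg := step_fun_BCg DD Ds g_nd.
split; first exact: bounded_itvB f_BCg.1 step_BCg.1.
have fCc := (BCgB f_BCg step_BCg).2.
have fC_right t : t \in `[a, b[ ->
    (f \- stepD) s @[s --> t^'+] --> (f \- stepD) t.
  move=> tab; have at_ : a <= t by move: tab; rewrite in_itv/= => /andP[].
  rewrite -[X in _ --> X]/(f t - stepD t).
  have -> : f t - stepD t = (f t + jump f t) - (stepD t + jump f t).
    by rewrite opprD addrACA subrr addr0.
  apply: cvgB; first exact: cvg_right_jump.
  rewrite -(unordered_sum1 (jump f) t).
  (* If [t] is not in [D], both sides are 0 because [f] has no jump there. *)
  have -> : unordered_sum [set t] (jump f) = unordered_sum ([set t] `&` D) (jump f).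
    apply: eq_unordered_sum => [s []//|s -> nDt].
    by apply: jump_notin_D => // Dt; apply: nDt.
  exact: step_fun_cvg_right.
have fC_left t : t \in `]a, b] ->
    (f \- stepD) s @[s --> t^'-] --> (f \- stepD) t.
  rewrite in_itv/= => /andP[at_ tb]; apply: (g_continuous_cvg fCc).
  - by rewrite in_itv/= tb ltW.
  - exact: g_lc.
  - near=> s; rewrite in_itv/=; apply/andP; split.
      by near: s; exact: nbhs_left_ge.
    by apply: le_trans tb; near: s; exact: nbhs_left_le.
apply/continuous_within_itvP => //; split.
- move=> t; rewrite in_itv/= => /andP[at_ tb]; apply/left_right_continuousP.
  by split; [apply: fC_left|apply: fC_right]; rewrite in_itv/= ?at_ ?tb ltW.
- by apply: fC_right; rewrite in_itv/= lexx.
- by apply: fC_left; rewrite in_itv/= lexx ab.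
Unshelve. all: by end_near. Qed.

Lemma jumps_summable_decomposition : jumps_summable ->
  [/\ (forall s, s \in `[a, b[ -> cvg (f x @[x --> s^'+])) /\
      (forall t, t \in `[a, b] -> abs_summable `[a, t[ (jump f)),
      abs_cont (jump_part g) a b fB /\ abs_cont g a b fB
    & BCg g a b (f \- fB) /\ BC a b (f \- fB)].
Proof.
move=> Ds; have DD : D `<=` D by [].
have fCE : {in `[a, b], f \- stepD =1 f \- fB}.
  by move=> t tab /=; rewrite unordered_sum_jumpE.
split; split.
- exact: is_cvg_right_itvco.
- by move=> t tab; exact: abs_summable_jump.
- apply: (abs_cont_eq unordered_sum_jumpE).
  apply: (step_fun_abs_cont (g := g)) => // [x y xy|c s e [Dgs _]].
    rewrite -subr_ge0 jump_part_sub// fine_ge0// esum_ge0// => s _.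
    by rewrite lee_fin jump_ge0.
  exact: jump_le_jump_part.
- apply: (abs_cont_eq unordered_sum_jumpE).
  by apply: (step_fun_abs_cont (g := g)) => // c s e _; exact: jump_le.
- apply: BCg_eq fCE _; apply: BCgB => //; exact: step_fun_BCg.
- by apply: BC_eq fCE _; exact: continuous_part_BC.
Qed.

Lemma cvg_stieltjes_quotient t : D t ->
  stieltjes_quotient g f t s @[s --> t^'+] -->
  (jump (g : R -> R^o) t)^-1 *: jump f t.
Proof.
move=> Dt; apply: cvgZ.
  apply: cvgV; first by rewrite gt_eqF//; exact: Dt.1.
  by apply: cvgB; [exact: rlim_cvg|exact: cvg_cst].
by apply: cvgB; [exact: f_rlim|exact: cvg_cst].
Qed.

(** The integrand lives on the countable set [D], and the mass of [t] is the jump of [g] at [t],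
    which cancels the denominator of the derivative. *)
Lemma stieltjes_derive_integral :
  (\int[mu_g g_nd]_(x in `[a, b])
      (`|patch (fun=> 0) D (stieltjes_derive g f) x|)%:E =
  \esum_(t in D) (`|jump f t|)%:E)%E.
Proof.
have -> : (fun x => (`|patch (fun=> 0) D (stieltjes_derive g f) x|)%:E) =
    (fun x => (`|stieltjes_derive g f x|)%:E) \_ D.
  by apply/funext => x; rewrite /patch; case: ifPn => // _; rewrite normr0.
rewrite -integral_mkcondr setIidr; last first.
  by move=> t [_]; rewrite /= !in_itv/= => /andP[-> /ltW].
rewrite countable_integral//; first last.
- exact: jump_set_itv_countable.
- exact: mu_g_measurable_set1.
apply: eq_esum => t Dt; rewrite [X in (_ * X)%E](mu_g_set1 g_nd g_lc t) -EFinM.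
have jt : 0 < jump (g : R -> R^o) t := Dt.1.
rewrite /stieltjes_derive (cvg_lim _ (cvg_stieltjes_quotient Dt))//.
by rewrite normrZ gtr0_norm ?invr_gt0// mulrAC -/(jump _ _) mulVf ?mul1r ?gt_eqF.
Qed.

(** The right limits of [f] give the derivative on all of [D], and a function vanishing off a
    countable set is measurable; what remains is finiteness of the integral. *)
Lemma stieltjes_derive_L1 :
  ((forall t, D t -> stieltjes_derivable g f t) /\
   L1 (mu_g g_nd) `[a, b] (patch (fun=> 0) D (stieltjes_derive g f))) <->
  jumps_summable.
Proof.
rewrite /L1 stieltjes_derive_integral; split=> [[_ []]//|Ds]; split.
  by move=> t /cvg_stieltjes_quotient qt; apply/cvg_ex; eexists; exact: qt.
split=> //; apply: countable_patch_measurable.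
- exact: mu_g_measurable_set1.
- by apply: mu_g_measurable_itvcc; exact: ltW.
- exact: jump_set_itv_countable.
Qed.

End equivalences.

(** * Series of jumps along sequences *)

Section jump_series.
Context {R : realType} {F : scalar_field}.
Notation V := (scalars R F).
Variables (a b : R) (g : R -> R) (u : R -> V).
Hypothesis ab : a < b.
Hypothesis g_nd : {homo g : x y / x <= y}.

Notation D := (jump_set g `&` `[a, b[).
Notation jump_sum t := (fun n x => \sum_(0 <= k < n | t k < x) u (t k)).

Lemma jump_sum_cvg (t : nat -> R) : abs_summable D u ->
  injective t -> (forall n, D (t n)) -> cvg_in_BCg g a b (jump_sum t).
Proof.
move=> Du t_inj Dt.
have tD : range t `<=` D by move=> _ [n _ <-].
have tu : abs_summable (range t) u by apply: le_lt_trans Du; exact: esum_le_subset.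
have tI n : t @` `I_n `<=` range t by move=> _ [k _ <-]; exists k.
have tIu n : abs_summable (t @` `I_n) u.
  by apply: le_lt_trans tu; exact: esum_le_subset.
have at_ k : a <= t k by have [_ /=] := Dt k; rewrite in_itv/= => /andP[].
have jump_sumE n : jump_sum t n = step_fun a (t @` `I_n) u.
  by apply/funext => x; rewrite step_fun_image.
split=> [n|].
  rewrite [X in BCg _ _ _ X]jump_sumE; apply: step_fun_BCg => //.
  exact: subset_trans (tI n) tD.
exists (step_fun a (range t) u); first exact: step_fun_BCg.
apply/cvgr0Pnorm_le => e e0.
have [//|B [finB Bt tailB]] := esum_tail_lt _ tu e0.
(* The first [N] terms exhaust the finite set [B], so every later remainder is bounded by the tail
   outside [B], uniformly in [x]. *)
have [N BN] : exists N, B `<=` t @` `I_N.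
  have /finite_fsetP[X XE] : finite_set (t @^-1` B).
    by apply: finite_preimage finB => x y _ _; exact: t_inj.
  (* The successor is needed because [I_N] holds the indices strictly below [N]. *)
  exists (\max_(k <- X) k).+1 => s Bs; have [k _ tk] := Bt _ Bs.
  exists k => //=; rewrite ltnS; apply: leq_bigmax_seq => //.
  have : (t @^-1` B) k by rewrite /= tk.
  by rewrite XE.
near=> n.
have Nn : (N <= n)%N by near: n; exact: nbhs_infty_ge.
suff tail_le : forall x, x \in `[a, b] ->
    `|(jump_sum t n \- step_fun a (range t) u) x| <= e.
  by have /andP[s0 se] := sup_norm_itv ab tail_le; rewrite ger0_norm.
move=> x _; rewrite [X in (X \- _) x]jump_sumE /=.
have -> : step_fun a (range t) u x = step_fun a (t @` `I_n) u x +
    unordered_sum (`[a, x[ `&` (range t `\` t @` `I_n)) u.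
  rewrite /step_fun -unordered_sumU.
  - by rewrite -setIUr setDUK//; exact: tI.
  - by apply/seteqP; split=> // s [[_ ?] [_ []]].
  - apply: le_lt_trans tu; apply: esum_le_subset => s [[_ [k _ <-]]|[_ []//]].
    by exists k.
rewrite opprD addrA subrr sub0r normrN -lee_fin.
apply: le_trans (norm_unordered_sum_le _) _.
  by apply: le_lt_trans tu; apply: esum_le_subset => s [_ []].
apply: le_trans (ltW tailB); apply: esum_le_subset => s [_ [ts ns]].
split=> // /BN [k /= kN tk]; apply: ns; exists k => //=.
exact: leq_trans kN Nn.
Unshelve. all: by end_near. Qed.

Lemma jump_sum_cvg_abs_summable :
  (forall x y, countable (jump_set g `&` `[x, y[)) ->
  (forall t : nat -> R, injective t -> (forall n, D (t n)) ->
    cvg_in_BCg g a b (jump_sum t)) ->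
  abs_summable D u.
Proof.
move=> cD cvg_t; have [s [sD s_le s_ge]] := scalars_functionals R F.
(* The norms are dominated by finitely many positive parts, so it suffices to bound the sum for a
   single functional [p]. *)
apply: le_lt_trans (_ : (\esum_(x in D) \sum_(p <- s) (Num.max (p (u x)) 0)%:E < +oo)%E).
  by apply: le_esum => x _; rewrite sumEFin lee_fin.
rewrite esum_sum; last by move=> x p _ _; rewrite lee_fin le_max lexx orbT.
rewrite big_seq; apply: lte_sum_pinfty => p ps.
pose P := D `&` [set x | 0 < p (u x)].
have -> : \esum_(x in D) (Num.max (p (u x)) 0)%:E = \esum_(x in P) (p (u x))%:E.
  rewrite [RHS]esum_mkcondr; apply: eq_esum => x _.
  rewrite maxEle; case: leP => px; last by rewrite mem_set.
  by rewrite memNset//=; apply/negP; rewrite -leNgt.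
have [finP|infP] := pselect (finite_set P).
  rewrite esum_fset//; last by move=> x /set_mem[_ /ltW]; rewrite lee_fin.
  by rewrite fsbig_finite//= sumEFin ltry.
have cP : countable P.
  by apply: sub_countable (cD a b); apply: subset_card_le => x [].
(* The sequence to which the hypothesis applies enumerates the points where [p] is positive. *)
have := eq_card_nat cP infP; rewrite card_eq_sym => /pcard_eqP/bijPex[t t_bij].
have t_inj : injective t by move=> x y; apply: (set_bij_inj t_bij); rewrite inE.
have Pt n : P (t n) by apply: (set_bij_sub t_bij).
have Dt n : D (t n) by have [] := Pt n.
have [tn_BCg [v v_BCg tv]] := cvg_t t t_inj Dt.
have bab : b \in `[a, b] by rewrite in_itv/= lexx ltW.
have p0 : p 0 = 0 by apply: (addIr (p 0)); rewrite -sD// !add0r.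
(* All points of [D] lie to the left of [b], so no term is dropped at [b], and additivity takes [p]
   outside the sum. *)
have partial_sumE n : (\sum_(0 <= i < n) (p (u (t i)))%:E)%E =
    (p (jump_sum t n b))%:E.
  rewrite sumEFin; congr EFin; elim: n => [|n IHn]/=; first by rewrite !big_geq.
  rewrite big_nat_recr//= IHn [in RHS]big_mkcond [in RHS]big_nat_recr//=.
  rewrite -big_mkcond/= (sD _ ps); congr (_ + p _).
  by have [_] := Dt n; rewrite /= in_itv/= => /andP[_ ->].
rewrite (reindex_esum setT P t)// -nneseries_esumT; last first.
  by move=> n; rewrite lee_fin ltW//; have [] := Pt n.
(* The partial sums at [b] are eventually within 1 of [v b] by convergence in sup norm, and [p] is
   bounded by the norm. *)
apply: le_lt_trans (ltry (`|v b| + 1)).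
apply: lime_le.
  by apply: is_cvg_nneseries => n _ _; rewrite lee_fin ltW//; have [] := Pt n.
near=> n.
rewrite partial_sumE lee_fin (le_trans (s_le _ ps _))//.
rewrite -[X in `|X|](subrK (v b)) addrC (le_trans (ler_normD _ _))// lerD2l.
apply: le_trans (_ : sup_norm a b (jump_sum t n \- v) <= 1).
  by apply: (@le_sup_norm _ _ _ _ (jump_sum t n \- v)) => //; apply: bounded_itvB;
    [exact: (tn_BCg n).1|exact: v_BCg.1].
rewrite (le_trans (ler_norm _))//; near: n.
by move/cvgr0Pnorm_le : tv; apply.
Unshelve. all: by end_near. Qed.

End jump_series.

(** * The cycle of implications *)

Theorem lemma6p1 (R : realType) (F : scalar_field) (a b : R) (g : R -> R)
    (f : R -> scalars R F) (ab : a < b)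
    (g_nd : {homo g : x y / x <= y})
    (g_lc : forall x, g s @[s --> x^'-] --> g x)
    (f_BCg : BCg g a b f)
    (f_rlim : forall t, (jump_set g `&` `[a, b[) t -> cvg (f s @[s --> t^'+])) :
  let D := jump_set g `&` (`[a, b[) in
  let h := patch (fun=> 0) D (stieltjes_derive g f) in
  let fB t := unordered_sum `[a, t[ (jump f) in
  let fC := f \- fB in
  [<-> (\esum_(t in D) (`|jump f t|)%:E < +oo)%E ;
       finite_set D \/
       (forall t : nat -> R, injective t -> (forall n, D (t n)) ->
         cvg_in_BCg g a b
           (fun n x => \sum_(0 <= k < n | t k < x) jump f (t k))) ;
       (forall t, D t -> stieltjes_derivable g f t) /\
       L1 (mu_g g_nd) `[a, b] h ;
       [/\ (forall s, s \in `[a, b[ -> cvg (f x @[x --> s^'+])) /\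
           (forall t, t \in `[a, b] -> abs_summable `[a, t[ (jump f)),
           abs_cont (jump_part g) a b fB /\ abs_cont g a b fB
         & BCg g a b fC /\ BC a b fC] ].
Proof.
move=> D h fB fC.
have L1P := stieltjes_derive_L1 ab g_nd g_lc f_rlim.
tfae.
- by move=> Ds; right=> t t_inj Dt; exact: jump_sum_cvg.
(* The implication from 2 to 3 passes through 1, which [L1P] identifies with 3. *)
- move=> cvgD; apply/L1P; case: cvgD => [finD|cvgD].
    by rewrite esum_fset// fsbig_finite//= sumEFin ltry.
  apply: jump_sum_cvg_abs_summable cvgD => //.
  exact: jump_set_itv_countable.
- by move=> /L1P; exact: jumps_summable_decomposition.
(* At [t = b] the summability in 4 covers [[a, b[], which contains [D]. *)
- move=> [[_ sumf] _ _]; have := sumf b; rewrite in_itv/= lexx (ltW ab) => /(_ erefl).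
  by apply: le_lt_trans; apply: esum_le_subset => t [].
Qed.
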